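(* If $(X,f)$ is a nontrivial equicontinuous dynamical system and $f$ is surjective, then $f$ does not have the $\underline{d}$-shadowing property.
   Context: $\mathbb{N}_0=\{0,1,2,\dots\}$. A dynamical system $(X,f)$ is a compact metric space $(X,d)$ together with a continuous map $f\colon X\to X$; it is nontrivial if $X$ has at least two points. $f$ is equicontinuous if for every $\varepsilon>0$ there is $\delta>0$ such that $d(x,y)<\delta$ implies $d(f^n(x),f^n(y))<\varepsilon$ for all $n\in\mathbb{N}_0$. For $A\subset\mathbb{N}_0$, $\underline{d}(A)=\liminf_{n\to\infty}\frac1n|A\cap\{0,\dots,n-1\}|$. A sequence $\{x_i\}_{i=0}^\infty\subset X$ is a $\delta$-ergodic pseudo-orbit of $f$ if $\lim_{n\to\infty}\frac1n|\{0\le i<n: d(f(x_i),x_{i+1})\ge\delta\}|=0$. $(X,f)$ has the $\underline{d}$-shadowing property if for every $\varepsilon>0$ there is $\delta>0$ such that for every $\delta$-ergodic pseudo-orbit $\{x_i\}_{i=0}^\infty$ there is $z\in X$ with $\underline{d}(\{i\in\mathbb{N}_0: d(f^i(z),x_i)<\varepsilon\})>0$. *)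

(* Defs.v *)
From HB Require Import structures.
From mathcomp Require Import all_boot all_order all_algebra.
From mathcomp Require Import all_classical all_reals all_analysis.

Set Implicit Arguments.
Unset Strict Implicit.
Unset Printing Implicit Defensive.

Import Order.TTheory GRing.Theory Num.Theory.
Import numFieldNormedType.Exports.

Local Open Scope classical_set_scope.
Local Open Scope ring_scope.

(* At n = 0 the value is 0 (division by zero), which affects neither limits nor
   lower limits as n tends to infinity. *)
Definition frequency (R : realType) (A : set nat) (n : nat) : R :=
  #|[pred i : 'I_n | (i : nat) \in A]|%:R / n%:R.

(* Frequencies lie in [0, 1], so limn_inf is the genuine lower limit here. *)
Definition lower_density (R : realType) (A : set nat) : R :=
  limn_inf (frequency R A).

(* Uniform over the space, unlike the pointwise [equicontinuous] of
   MathComp-Analysis. *)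
Definition equicontinuous_system (R : realType) (X : metricType R)
    (f : X -> X) : Prop :=
  forall eps : R, 0 < eps -> exists2 delta : R, 0 < delta &
    forall x y : X, mdist x y < delta ->
      forall n : nat, mdist (iter n f x) (iter n f y) < eps.

Definition ergodic_pseudo_orbit (R : realType) (X : metricType R)
    (f : X -> X) (delta : R) (x : nat -> X) : Prop :=
  frequency R [set i | delta <= mdist (f (x i)) (x i.+1)] @ \oo --> (0 : R).

Definition lower_density_shadowing (R : realType) (X : metricType R)
    (f : X -> X) : Prop :=
  forall eps : R, 0 < eps -> exists2 delta : R, 0 < delta &
    forall x : nat -> X, ergodic_pseudo_orbit f delta x ->
      exists z : X,
        0 < lower_density R [set i | mdist (iter i f z) (x i) < eps].

(* Main.v *)
Require Import Defs.
From HB Require Import structures.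
From mathcomp Require Import all_boot all_order all_algebra.
From mathcomp Require Import all_classical all_reals all_analysis.
From mathcomp Require Import lra zify.

Import Order.TTheory GRing.Theory Num.Theory.
Import numFieldNormedType.Exports.

Local Open Scope classical_set_scope.
Local Open Scope ring_scope.

(** An equicontinuous surjection of a compact space brings any pair of points
    simultaneously back near itself, at arbitrarily late times
    ([equicontinuous_surjection_recurrent]).  Hence the orbits of two distinct
    points [a] and [b] stay apart, and more: once a point [z] comes close to the
    orbit of [a] at one time it stays close to it by equicontinuity, so if it
    also came close to the orbit of [b] at another time, then at a late return
    time of the pair the points [a] and [b] themselves would be close.  For a
    suitable [eps], no [z] can be [eps]-close both to the orbit of [a] at some
    time and to the orbit of [b] at some time ([shadow_at_most_one_orbit]).

    It remains to mix the two orbits.  Cut time into the blocks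
    [2 ^ 2 ^ k <= i < 2 ^ 2 ^ k.+1], and follow the orbit of [a] on the blocks
    of even number and that of [b] on those of odd number.  The only errors are
    at the ends of the blocks, and these have density 0
    ([block_change_frequency_cvg0]), so this is an ergodic pseudo-orbit
    for every tolerance.  A point [z] that shadows it can only be successful on
    blocks of one parity; since each block is much longer than everything before
    it, the set of successful times is negligible at the end of every block of
    the other parity, and its lower density is 0
    ([lower_density_avoiding_parity]). *)

(** Two terms close to the same cluster point are close to each other. *)
Lemma compact_sequence_returns (R : realType) (T : pseudoMetricType R)
    (u : nat -> T) (eps : R) (N : nat) :
  compact [set: T] -> 0 < eps ->
  exists k l, (k + N <= l)%N /\ ball (u k) eps (u l).
Proof.
move=> T_compact eps0.
have [p [_ u_p]] := T_compact (u @ \oo) _ filterT.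
have near_p n : exists2 k, (n <= k)%N & ball p (eps / 2) (u k).
  have [||_ [[k nk <-] pk]] := u_p [set u k | k in [set k | (n <= k)%N]]
                                 (ball p (eps / 2)).
  - exists n => // k /= nk; exists k => //.
  - by apply: nbhsx_ballx; rewrite divr_gt0.
  - by exists k.
have [k _ pk] := near_p 0%N; have [l kNl pl] := near_p (k + N)%N.
by exists k, l; split=> //; apply: ball_splitr pk pl.
Qed.

(** Compactness gives close points among iterated preimages of [(x, y)].  If
    those of depths [k < l] are close, applying [iter l f] keeps them close and
    turns them into the pair moved [l - k] steps forward and the pair itself. *)
Lemma equicontinuous_surjection_recurrent (R : realType) (X : metricType R)
    (f : X -> X) (x y : X) (eps : R) (N : nat) :
    compact [set: X] -> equicontinuous_system f ->
    set_surj [set: X] [set: X] f -> 0 < eps ->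
  exists m, [/\ (N <= m)%N, mdist x (iter m f x) < eps
              & mdist y (iter m f y) < eps].
Proof.
move=> X_compact f_equi f_surj eps0.
have [g fg] : exists g, cancel g f.
  suff /choice[g fg] : forall z, exists w, f w = z by exists g.
  by move=> z; have [w _ <-] := f_surj z I; exists w.
have iter_fg k l z : (k <= l)%N -> iter l f (iter k g z) = iter (l - k) f z.
  elim: k l => [|k IHk] [|l] //; rewrite ltnS => kl.
  by rewrite iterSr /= fg IHk.
have [delta delta0 f_delta] := f_equi _ eps0.
have XX_compact : compact [set: X * X].
  by rewrite -setXTT; apply: compact_setX.
have [k [l [kNl]]] := compact_sequence_returns R (X * X)%type
  (fun k => (iter k g x, iter k g y)) delta N XX_compact delta0.
rewrite /ball/= /prod_ball/= !ballEmdist /= => -[klx kly].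
exists (l - k)%N; split; first by lia.
  have := f_delta _ _ klx l.
  by rewrite !iter_fg// ?subnn 1?metric_sym//; lia.
have := f_delta _ _ kly l.
by rewrite !iter_fg// ?subnn 1?metric_sym//; lia.
Qed.

(** At a return time [m >= i, j] of the pair, equicontinuity has kept both
    approximations alive, so [a], [iter m f a], [iter m f z], [iter m f b], [b]
    is a chain from [a] to [b] with four short steps. *)
Lemma shadow_at_most_one_orbit (R : realType) (X : metricType R) (f : X -> X)
    (a b : X) :
    compact [set: X] -> equicontinuous_system f ->
    set_surj [set: X] [set: X] f -> a <> b ->
  exists2 eps : R, 0 < eps & forall z i j,
    mdist (iter i f z) (iter i f a) < eps ->
    mdist (iter j f z) (iter j f b) < eps -> False.
Proof.
move=> X_compact f_equi f_surj /eqP; rewrite -mdist_gt0 => ab0.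
have eta0 : 0 < mdist a b / 4 by lra.
have [eps eps0 f_eps] := f_equi _ eta0; exists eps => // z i j zia zjb.
have [m [ijm ma mb]] := equicontinuous_surjection_recurrent R X f a b _ (i + j)
  X_compact f_equi f_surj eta0.
have := f_eps _ _ zia (m - i)%N; rewrite -!iterD subnK; last by lia.
have := f_eps _ _ zjb (m - j)%N; rewrite -!iterD subnK; last by lia.
move=> zmb zma.
have := metric_triangle a (iter m f a) b.
have := metric_triangle (iter m f a) (iter m f z) b.
have := metric_triangle (iter m f z) (iter m f b) b.
rewrite (metric_sym (iter m f b) b) (metric_sym (iter m f a) (iter m f z)).
lra.
Qed.

Lemma frequencyE (R : realType) (A : set nat) (n : nat) :
  frequency R A n = (\sum_(i < n) ((i : nat) \in A))%:R / n%:R.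
Proof.
by rewrite /frequency -sum1_card big_mkcond; congr (_%:R / _); apply: eq_bigr.
Qed.

(** As frequencies are nonnegative, small values at arbitrarily late times make
    the infimum of every tail exactly 0, and the lower limit is that of a
    constant sequence. *)
Lemma lower_density_eq0 (R : realType) (A : set nat) :
    (forall (eps : R) N, 0 < eps ->
      exists2 n, (N <= n)%N & frequency R A n <= eps) ->
  lower_density R A = 0.
Proof.
move=> A_small; rewrite /lower_density /limn_inf.
suff -> : infs (frequency R A) = cst 0 by exact: lim_cst.
apply/funext => N /=; apply/eqP; rewrite eq_le; apply/andP; split.
  apply/ler_addgt0Pl => eps eps0; rewrite addr0.
  have [n Nn An] := A_small _ N eps0; apply: le_trans An.
  apply: ge_inf; last by exists n.
  by exists 0 => _ [k _ <-]; rewrite divr_ge0.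
apply: lb_le_inf; first by exists (frequency R A N); exists N => /=.
by move=> _ [k _ <-]; rewrite divr_ge0.
Qed.

(** The number [k] of the time block [2 ^ 2 ^ k <= n < 2 ^ 2 ^ k.+1]; times 0
    and 1 are put into block 0. *)
Definition block (n : nat) : nat := trunc_log 2 (trunc_log 2 n).

Lemma leq_block m n : (m <= n)%N -> (block m <= block n)%N.
Proof. by move=> mn; rewrite !leq_trunc_log. Qed.

Lemma block_eq k n : (2 ^ 2 ^ k <= n < 2 ^ 2 ^ k.+1)%N -> block n = k.
Proof.
case/andP=> kn nk; apply: trunc_log_eq => //; apply/andP; split.
  exact: trunc_log_max.
rewrite -(ltn_exp2l _ _ (ltnSn 1)); apply: leq_ltn_trans nk.
by apply: trunc_logP => //; apply: leq_trans kn; rewrite expn_gt0.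
Qed.

(** A crude growth bound, which suffices to make [block n / n] tend to 0. *)
Lemma sqr_block_leq n : (block n ^ 2 <= n)%N.
Proof.
have sqr_leq k : (k ^ 2 <= 2 ^ 2 ^ k)%N.
  case: k => // k; apply: (@leq_trans (2 ^ (k.+1 * 2))).
    by rewrite expnM leq_exp2r// ltnW// ltn_expl.
  by rewrite leq_exp2l// expnSr leq_mul2r ltn_expl.
have [->|n0] := posnP n; first by rewrite /block !trunc_log0.
have [l0|l0] := posnP (trunc_log 2 n); first by rewrite /block l0 trunc_log0.
apply: leq_trans (sqr_leq _) (leq_trans _ (trunc_logP (ltnSn 1) n0)).
by rewrite leq_exp2l// trunc_logP.
Qed.

(** Since [block] is nondecreasing, it changes at most [block n] times before
    [n]. *)
Lemma block_change_frequency_cvg0 (R : realType) (A : set nat) :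
    A `<=` [set i | block i != block i.+1] ->
  frequency R A @ \oo --> (0 : R).
Proof.
move=> A_change.
have count_le n : (\sum_(i < n) ((i : nat) \in A) <= block n)%N.
  elim: n => [|n IHn]; first by rewrite big_ord0.
  rewrite big_ord_recr /=; apply: (leq_trans (leq_add IHn (leqnn _))).
  have := leq_block _ _ (leqnSn n).
  by case: (boolP (n \in A)) => [/set_mem/A_change/=|_]; lia.
apply/cvgrPdist_le => eps eps0.
have [M M_eps] : exists M : nat, eps^-1 < M%:R.
  by exists (Num.bound eps^-1); rewrite archi_boundP// invr_ge0 ltW.
near=> n.
have M2n : (M ^ 2 <= n)%N by near: n; exact: nbhs_infty_ge.
have Mblock : (M * block n <= n)%N.
  (* If [block n < M], use [M ^ 2 <= n]; otherwise [block n ^ 2 <= n]. *)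
  by have := sqr_block_leq n; have [] := leqP M (block n); nia.
have n0 : (0 < n)%N by near: n; exact: nbhs_infty_gt.
rewrite sub0r normrN frequencyE ger0_norm ?divr_ge0// ler_pdivrMr ?ltr0n//.
apply: (@le_trans _ _ (block n)%:R); first by rewrite ler_nat.
rewrite -ler_pdivrMl//.
apply: (@le_trans _ _ (M%:R * (block n)%:R)).
  by rewrite ler_wpM2r// ltW.
by rewrite -natrM ler_nat.
Unshelve. all: by end_near. Qed.

(** At the end [2 ^ 2 ^ k.+1] of a block [k] that [A] avoids, [A] has at most
    [2 ^ 2 ^ k] elements, the square root of the elapsed time. *)
Lemma lower_density_avoiding_parity (R : realType) (A : set nat) (b : bool) :
    (forall i, A i -> odd (block i) != b) ->
  lower_density R A = 0.
Proof.
move=> A_b; apply: lower_density_eq0 => eps N eps0.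
pose M := Num.bound eps^-1.
have M_eps : eps^-1 < M%:R by rewrite archi_boundP// invr_ge0 ltW.
(* A late block of the avoided parity. *)
pose k := (b + (M + N).*2)%N.
have k_b : odd k = b by rewrite oddD odd_double addbF oddb.
have k_lt : (k < 2 ^ 2 ^ k)%N by apply: ltn_trans (ltn_expl _ _) (ltn_expl _ _).
exists (2 ^ 2 ^ k.+1)%N.
  have : (k.+1 < 2 ^ 2 ^ k.+1)%N.
    by apply: ltn_trans (ltn_expl _ _) (ltn_expl _ _).
  by rewrite /k; lia.
have count_le n : (n <= 2 ^ 2 ^ k.+1 ->
    \sum_(i < n) ((i : nat) \in A) <= 2 ^ 2 ^ k)%N.
  elim: n => [|n IHn] nk; first by rewrite big_ord0.
  have [kn|kn] := leqP (2 ^ 2 ^ k) n; last first.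
    apply: leq_trans kn; rewrite -[leqRHS]muln1 -[X in (X * 1)%N]card_ord.
    by rewrite -sum_nat_const leq_sum// => i _; case: (_ \in _).
  rewrite big_ord_recr /=.
  have /negPf -> : n \notin A.
    by apply/negP => /set_mem/A_b; rewrite (block_eq k) ?kn// k_b eqxx.
  by rewrite addn0 IHn// ltnW.
rewrite frequencyE ler_pdivrMr ?ltr0n ?expn_gt0//.
apply: (@le_trans _ _ (2 ^ 2 ^ k)%:R); first by rewrite ler_nat count_le.
rewrite -ler_pdivrMl//.
apply: (@le_trans _ _ (M%:R * (2 ^ 2 ^ k)%:R)).
  by rewrite ler_wpM2r// ltW.
rewrite -natrM ler_nat (expnSr 2 k) expnM -mulnn leq_mul2r.
by apply/orP; right; rewrite /k in k_lt *; lia.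
Qed.

Theorem theorem7p7 (R : realType) (X : metricType R) (f : X -> X)
    (X_compact : compact [set: X]) (f_continuous : continuous f)
    (X_nontrivial : exists x y : X, x <> y)
    (f_equicontinuous : equicontinuous_system f)
    (f_surjective : set_surj [set: X] [set: X] f) :
  ~ lower_density_shadowing f.
Proof.
have [a [b ab]] := X_nontrivial.
have [eps eps0 one_orbit] := shadow_at_most_one_orbit R X f a b X_compact
  f_equicontinuous f_surjective ab.
move=> /(_ _ eps0) [delta delta0 f_shadow].
pose x i := iter i f (if odd (block i) then b else a).
have [|z] := f_shadow x.
  apply: block_change_frequency_cvg0 => i /=; apply: contraTneq => block_iS.
  by rewrite /x -block_iS iterS mdistxx -ltNge.
suff [c z_c] : exists c, forall i, mdist (iter i f z) (x i) < eps ->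
    odd (block i) != c.
  by rewrite (lower_density_avoiding_parity _ _ c)// ltxx.
have [[i zia]|no_a] :=
  pselect (exists i, mdist (iter i f z) (iter i f a) < eps).
  exists true => j; rewrite /x; case: odd => // zjb.
  by have := one_orbit _ _ _ zia zjb.
exists false => j; rewrite /x; case: odd => // zja.
by case: no_a; exists j.
Qed.
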